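(* Let $(x_n)_{n\geq 0}$ be a sequence of integers satisfying $x_n=b_1x_{n-1}+b_2x_{n-2}+b_3x_{n-3}$ for all integers $n\geq 3$, where $b_1,b_2,b_3,x_0,x_1,x_2\in\mathbb{Z}$ and $b_3\neq 0$. Suppose that the characteristic polynomial $x^3-b_1x^2-b_2x-b_3$ equals $(x-a)(x-b)(x-c)$ with $a,b,c\in\mathbb{Z}$. Let $p$ be a prime with $p\nmid abc$. Then: (a) Suppose $a=b=c$. If $p\mid x_0$ and $p\nmid 4ax_1-x_2-3a^2x_0$, then the quotient set of $(x_n)_{n\geq 0}$ is dense in $\mathbb{Q}_p$. Moreover, if $x_0=0$, then the quotient set of $(x_n)_{n\geq 0}$ is dense in $\mathbb{Q}_p$ if and only if $4ax_1\neq x_2$. (b) Suppose $a=c\neq b$. If $p\mid x_0$ and $p\nmid (a-b)\bigl(x_2-x_1(a+b)+x_0ab\bigr)$, then the quotient set of $(x_n)_{n\geq 0}$ is dense in $\mathbb{Q}_p$.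
   Context: The quotient set (ratio set) of a sequence $(x_n)_{n\ge0}$ of integers is $\{x_m/x_n : m,n\geq 0,\ x_n\neq 0\}$. $\mathbb{Q}_p$ denotes the field of $p$-adic numbers with the $p$-adic topology. *)

(* Defs.v *)
From HB Require Import structures.
From mathcomp Require Import all_boot all_order all_algebra.
From mathcomp Require Import ring_quotient.
From mathcomp Require Import boolp classical_sets functions topology.

Set Implicit Arguments.
Unset Strict Implicit.
Unset Printing Implicit Defensive.

Import Order.TTheory GRing.Theory Num.Theory.

Local Open Scope classical_set_scope.
Local Open Scope ring_scope.

(* The p-adic absolute value on rat. The field Q_p is built below as the
   completion of rat for it: Cauchy sequences modulo null sequences. Since
   [logn p] vanishes when p is not prime, the absolute value is then the trivial
   one, so the construction needs no primality hypothesis. *)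
Definition ratnorm (p : nat) (x : rat) : rat :=
  if x == 0 then 0
  else p%:R ^ ((logn p `|denq x|%N)%:Z - (logn p `|numq x|%N)%:Z).

Section RatNorm.
Variable p : nat.
Local Notation nrm := (ratnorm p).

Lemma logn_nprime m : ~~ prime p -> logn p m = 0%N.
Proof. by move=> np; rewrite lognE (negbTE np). Qed.

Lemma ratnorm0 : nrm 0 = 0.
Proof. by rewrite /ratnorm eqxx. Qed.

Lemma ratnorm_gt0 x : (0 < nrm x) = (x != 0).
Proof.
rewrite /ratnorm; case: eqVneq => [_|x0]; first by rewrite ltxx.
have [pp|np] := boolP (prime p).
  by rewrite exprz_gt0 // ltr0n prime_gt0.
by rewrite !logn_nprime // subrr expr0z.
Qed.

Lemma ratnorm_ge0 x : 0 <= nrm x.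
Proof.
have [->|x0] := eqVneq x 0; first by rewrite ratnorm0.
by rewrite ltW // ratnorm_gt0.
Qed.

Lemma ratnorm_eq0 x : (nrm x == 0) = (x == 0).
Proof.
by apply/idP/idP => [|/eqP->]; [apply: contraTT; rewrite -ratnorm_gt0 => /gt_eqF->
                               | rewrite ratnorm0].
Qed.

Lemma ratnorm_frac (n d : int) : n != 0 -> d != 0 ->
  nrm (n%:~R / d%:~R) = p%:R ^ ((logn p `|d|%N)%:Z - (logn p `|n|%N)%:Z).
Proof.
move=> n0 d0; set x := _ / _.
have x0 : x != 0 by rewrite mulf_neq0 // ?invr_eq0 intr_eq0.
have e : n * denq x = numq x * d.
  apply: (@intr_inj rat); rewrite !rmorphM /= numqE mulrAC divfK // intr_eq0 //.
rewrite /ratnorm (negbTE x0); congr (_ ^ _).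
have /(congr1 (logn p)) : (`|n| * `|denq x| = `|numq x| * `|d|)%N.
  by rewrite -!abszM e.
rewrite !lognM ?absz_gt0 ?denq_neq0 // ?numq_eq0 // => /(congr1 Posz).
rewrite !PoszD => E; apply/eqP; rewrite subr_eq addrAC eq_sym subr_eq.
by rewrite addrC -E addrC.
Qed.

Lemma ratnorm1 : nrm 1 = 1.
Proof. by rewrite /ratnorm oner_eq0 /= logn1 subrr expr0z. Qed.

Lemma ratnormN x : nrm (- x) = nrm x.
Proof. by rewrite /ratnorm oppr_eq0 numqN denqN abszN. Qed.

Lemma ratnormM x y : nrm (x * y) = nrm x * nrm y.
Proof.
have [->|x0] := eqVneq x 0; first by rewrite mul0r ratnorm0 mul0r.
have [->|y0] := eqVneq y 0; first by rewrite mulr0 ratnorm0 mulr0.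
have nx : numq x != 0 by rewrite numq_eq0.
have ny : numq y != 0 by rewrite numq_eq0.
have dx := denq_neq0 x; have dy := denq_neq0 y.
rewrite -{1}(divq_num_den x) -{1}(divq_num_den y) mulf_div -!intrM.
rewrite ratnorm_frac ?mulf_neq0 // /ratnorm (negbTE x0) (negbTE y0).
rewrite !abszM !lognM ?absz_gt0 //.
have [pp|np] := boolP (prime p); last by rewrite !logn_nprime // subrr expr0z mulr1.
rewrite -expfzDr ?pnatr_eq0 -?lt0n ?prime_gt0 //; congr (_ ^ _).
by rewrite !PoszD opprD addrACA.
Qed.

Lemma ratnormD x y : nrm (x + y) <= Num.max (nrm x) (nrm y).
Proof.
have [->|x0] := eqVneq x 0; first by rewrite add0r le_max lexx orbT.
have [->|y0] := eqVneq y 0; first by rewrite addr0 le_max lexx.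
have [->|z0] := eqVneq (x + y) 0.
  by rewrite ratnorm0 le_max ratnorm_ge0.
have [pp|np] := boolP (prime p); last first.
  by rewrite /ratnorm (negbTE x0) (negbTE y0) (negbTE z0) !logn_nprime // subrr
     expr0z maxxx.
pose d := denq x * denq y.
pose a := numq x * denq y; pose b := numq y * denq x.
have dx := denq_neq0 x; have dy := denq_neq0 y.
have a0 : a != 0 by rewrite mulf_neq0 // numq_eq0.
have b0 : b != 0 by rewrite mulf_neq0 // numq_eq0.
have d0 : d != 0 by rewrite mulf_neq0.
have xE : x = a%:~R / d%:~R.
  by rewrite -{1}(divq_num_den x) !intrM -mulf_div divff ?intr_eq0 // mulr1.
have yE : y = b%:~R / d%:~R.
  by rewrite -{1}(divq_num_den y) /b /d (mulrC (denq x)) !intrM -mulf_div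
     divff ?intr_eq0 // mulr1.
have zE : x + y = (a + b)%:~R / d%:~R by rewrite xE yE -mulrDl -intrD.
have ab0 : a + b != 0.
  by apply: contra_neq z0 => ab; rewrite zE ab mul0r.
rewrite zE xE yE !ratnorm_frac // le_max.
have p1 : 1 < (p%:R : rat) by rewrite ltr1n prime_gt1.
rewrite !ler_eXz2l // !lerD2l !lerN2 !lez_nat -!pfactor_dvdn ?absz_gt0 //.
have D k : (k <= logn p `|a| -> k <= logn p `|b| -> p ^ k %| `|(a + b)%R|)%N.
  rewrite -!pfactor_dvdn ?absz_gt0 // => ka kb.
  have -> : (p ^ k %| `|(a + b)%R|)%N = ((p ^ k)%N %| a + b)%Z by [].
  by rewrite rpredD.
have [l|/ltnW l] := leqP (logn p `|a|) (logn p `|b|).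
  by rewrite (D _ (leqnn _) l).
by rewrite (D _ l (leqnn _)) orbT.
Qed.

Lemma ratnormB x y : nrm (x - y) <= Num.max (nrm x) (nrm y).
Proof. by rewrite -[X in Num.max _ X]ratnormN ratnormD. Qed.

Lemma ratnorm_stable x y : nrm (x - y) < nrm y -> nrm x = nrm y.
Proof.
move=> h; apply/eqP; rewrite eq_le; apply/andP; split.
  by have := ratnormD (x - y) y; rewrite subrK (max_idPr (ltW h)).
have := ratnormB x (x - y); rewrite opprB addrC subrK le_max => /orP[//|].
by rewrite leNgt h.
Qed.

End RatNorm.

Definition cauchy_seq (p : nat) : pred (nat -> rat) := fun u =>
  `[< forall e : rat, 0 < e -> exists N, forall m n, (N <= m)%N -> (N <= n)%N ->
      ratnorm p (u m - u n) < e >].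

Definition null_seq (p : nat) (u : nat -> rat) : Prop :=
  forall e : rat, 0 < e -> exists N, forall n, (N <= n)%N -> ratnorm p (u n) < e.

Section CauchyRing.
Variable p : nat.

Lemma cauchy_seq_bounded (u : nat -> rat) : cauchy_seq p u ->
  exists2 B, 0 < B & exists N, forall n, (N <= n)%N -> ratnorm p (u n) <= B.
Proof.
move=> /asboolP/(_ 1 ltr01)[N h]; exists (Num.max 1 (ratnorm p (u N))).
  by rewrite lt_max ltr01.
exists N => n Nn; rewrite -(subrK (u N) (u n)).
apply: (le_trans (ratnormD _ _ _)); rewrite ge_max !le_max lexx orbT andbT.
by rewrite ltW // h.
Qed.

Fact cauchy_subring_closed : subring_closed (cauchy_seq p).
Proof.
split.
- by apply/asboolP => e e0; exists 0%N => m n _ _; rewrite subrr ratnorm0.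
- move=> u v /asboolP cu /asboolP cv; apply/asboolP => e e0.
  have [N hN] := cu e e0; have [M hM] := cv e e0.
  exists (maxn N M) => m n; rewrite !geq_max => /andP[Nm Mm] /andP[Nn Mn].
  rewrite !fctE opprD addrACA -opprD.
  apply: (le_lt_trans (ratnormB _ _ _)).
  by rewrite gt_max hN // hM.
- move=> u v cu cv; apply/asboolP => e e0.
  have [B B0 [Nb hB]] := cauchy_seq_bounded cu.
  have [C C0 [Nc hC]] := cauchy_seq_bounded cv.
  have [N hN] := asboolP _ cu (e / C) (divr_gt0 e0 C0).
  have [M hM] := asboolP _ cv (e / B) (divr_gt0 e0 B0).
  exists (maxn (maxn Nb Nc) (maxn N M)) => m n.
  rewrite !geq_max => /andP[/andP[b1 c1] /andP[n1 m1]].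
  move=> /andP[/andP[b2 c2] /andP[n2 m2]]; rewrite !fctE.
  have -> : u m * v m - u n * v n = u m * (v m - v n) + (u m - u n) * v n.
    by rewrite mulrBr mulrBl addrA subrK.
  apply: (le_lt_trans (ratnormD _ _ _)); rewrite gt_max !ratnormM; apply/andP; split.
    apply: (@le_lt_trans _ _ (B * ratnorm p (v m - v n))).
      by rewrite ler_wpM2r ?ratnorm_ge0 // hB.
    by rewrite mulrC -ltr_pdivlMr // hM.
  apply: (@le_lt_trans _ _ (ratnorm p (u m - u n) * C)).
    by rewrite ler_wpM2l ?ratnorm_ge0 // hC.
  by rewrite -ltr_pdivlMr // hN.
Qed.

HB.instance Definition _ :=
  GRing.isSubringClosed.Build (nat -> rat) (cauchy_seq p) cauchy_subring_closed.

Record cauchy := Cauchy { cauchy_val :> nat -> rat; _ : cauchy_seq p cauchy_val }.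

HB.instance Definition _ := [isSub for cauchy_val].
HB.instance Definition _ := [Choice of cauchy by <:].
HB.instance Definition _ := [SubChoice_isSubComNzRing of cauchy by <:].

Lemma cauchyP (u : cauchy) : cauchy_seq p u.
Proof. by case: u. Qed.

Definition null_ideal : pred cauchy := fun u => `[< null_seq p u >].

Lemma null_idealP (u : cauchy) : reflect (null_seq p u) (u \in null_ideal).
Proof. exact: asboolP. Qed.

Fact null_idealr_closed : idealr_closed null_ideal.
Proof.
split.
- by apply/null_idealP => e e0; exists 0%N => n _; rewrite ratnorm0.
- apply/null_idealP => /(_ 1 ltr01)[N /(_ N (leqnn N))].
  by rewrite /= ratnorm1 ltxx.
- move=> a u v /null_idealP nu /null_idealP nv; apply/null_idealP => e e0.
  have [B B0 [Nb hB]] := cauchy_seq_bounded (cauchyP a).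
  have [N hN] := nu (e / B) (divr_gt0 e0 B0).
  have [M hM] := nv e e0.
  exists (maxn Nb (maxn N M)) => n; rewrite !geq_max => /and3P[bn Nn Mn].
  apply: (le_lt_trans (ratnormD _ _ _)); rewrite gt_max hM // andbT ratnormM.
  apply: (@le_lt_trans _ _ (B * ratnorm p (u n))).
    by rewrite ler_wpM2r ?ratnorm_ge0 // hB.
  by rewrite mulrC -ltr_pdivlMr // hN.
Qed.

HB.instance Definition _ := isIdealr.Build cauchy null_ideal null_idealr_closed.

End CauchyRing.

Arguments null_ideal p u : clear implicits.

Definition null_idealr (p : nat) : idealr (cauchy p) :=
  Idealr.clone _ (null_ideal p) _.

Definition padic (p : nat) : Type := {ideal_quot (null_idealr p)}.

HB.instance Definition _ (p : nat) := GRing.ComNzRing.on (padic p).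
HB.instance Definition _ (p : nat) := EqQuotient.on (padic p).

Section PadicField.
Variable p : nat.
Local Open Scope quotient_scope.
Local Notation Q := (padic p).

Lemma padic_pi_eq0 (u : cauchy p) : (\pi_Q u == 0) = (u \in null_ideal p).
Proof. by rewrite -[0](rmorph0 (\pi_Q : cauchy p -> Q)) -Quotient.idealrBE subr0. Qed.

Lemma cauchy_eventually_const (u : cauchy p) : u \notin null_ideal p ->
  exists2 v, 0 < v & exists N, forall n, (N <= n)%N -> ratnorm p (u n) = v.
Proof.
move=> /null_idealP/existsNP[e /not_implyP[e0 /forallNP h]].
have [N hN] := asboolP _ (cauchyP u) e e0.
have /existsNP[m /not_implyP[Nm /negP]] := h N; rewrite -leNgt => em.
exists (ratnorm p (u m)); first exact: lt_le_trans em.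
exists N => n Nn; apply: ratnorm_stable.
by apply: (lt_le_trans _ em); exact: hN.
Qed.

Lemma padic_exists_inv (x : Q) : x != 0 -> exists y, y * x = 1.
Proof.
elim/quotW: x => u; rewrite padic_pi_eq0 => /cauchy_eventually_const[v v0 [N hN]].
pose w : nat -> rat := fun n => (u n)^-1.
have un n : (N <= n)%N -> u n != 0.
  by move=> Nn; rewrite -(ratnorm_gt0 p) hN.
have cw : cauchy_seq p w.
  apply/asboolP => e e0.
  have [M hM] := asboolP _ (cauchyP u) (e * (v * v)) (mulr_gt0 e0 (mulr_gt0 v0 v0)).
  exists (maxn N M) => m n; rewrite !geq_max => /andP[Nm Mm] /andP[Nn Mn].
  rewrite /w -(ltr_pM2r (mulr_gt0 v0 v0)) -{1}(hN _ Nm) -{1}(hN _ Nn) -!ratnormM.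
  have -> : ((u m)^-1 - (u n)^-1) * (u m * u n) = u n - u m.
    by rewrite mulrBl mulrA mulVf ?un // mul1r mulrCA mulVf ?un // mulr1.
  exact: hM.
exists (\pi_Q (Cauchy cw)); rewrite -rmorphM /= -[RHS](rmorph1 (\pi_Q : cauchy p -> Q)).
apply/eqP; rewrite -Quotient.idealrBE; apply/null_idealP => e e0.
exists N => n Nn; rewrite /= !fctE /w mulVf ?un // subrr ratnorm0 //.
Qed.

Definition padic_inv (x : Q) : Q := xget 0 [set y | y * x = 1].

Fact padic_mulVf (x : Q) : x != 0 -> padic_inv x * x = 1.
Proof. by move=> /padic_exists_inv; exact: (@xgetPex _ _ [set y | y * x = 1]). Qed.

Fact padic_invr0 : padic_inv 0 = 0.
Proof.
rewrite /padic_inv; case: xgetP => // y _ /eqP.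
by rewrite mulr0 eq_sym oner_eq0.
Qed.

HB.instance Definition _ :=
  GRing.ComNzRing_isField.Build (padic p) padic_mulVf padic_invr0.

(* |u n|_p is eventually constant unless u is a null sequence, for which the
   default value 0 is the limit (and the only possible eventual value). *)
Definition cauchy_norm (u : cauchy p) : rat :=
  xget 0 [set v | exists N, forall n, (N <= n)%N -> ratnorm p (u n) = v].

Definition padic_norm (x : Q) : rat := cauchy_norm (repr x).

Variant cauchy_norm_spec (u : cauchy p) : rat -> Prop :=
| CauchyNormNull of u \in null_ideal p : cauchy_norm_spec u 0
| CauchyNormConst v N of u \notin null_ideal p & 0 < v
    & (forall n, (N <= n)%N -> ratnorm p (u n) = v) : cauchy_norm_spec u v.

Lemma cauchy_normP (u : cauchy p) : cauchy_norm_spec u (cauchy_norm u).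
Proof.
have [nu|nu] := boolP (u \in null_ideal p).
  suff -> : cauchy_norm u = 0 by constructor.
  rewrite /cauchy_norm; case: xgetP => // v -> [N hN]; apply/eqP.
  rewrite eq_le -{2}(hN N) // ratnorm_ge0 andbT leNgt; apply/negP => v0.
  have /null_idealP/(_ _ v0)[M /(_ (maxn N M) (leq_maxr _ _))] := nu.
  by rewrite hN ?leq_maxl // ltxx.
have [v v0 [N hN]] := cauchy_eventually_const nu.
suff -> : cauchy_norm u = v by apply: CauchyNormConst hN.
apply: xget_unique; first by exists N.
move=> w [M hM]; rewrite -(hM (maxn N M)) ?leq_maxr // hN // leq_maxl //.
Qed.

Lemma padic_normE (u : cauchy p) : padic_norm (\pi_Q u) = cauchy_norm u.
Proof.
rewrite /padic_norm; set w := repr _.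
have uw : u - w \in null_ideal p by rewrite Quotient.idealrBE reprK.
case: (cauchy_normP u) => [nu|v N nu v0 hN].
  case: (cauchy_normP w) => // v N.
  by rewrite -[w in w \notin _](subKr u) rpredB.
case: (cauchy_normP w) => [nw|w' M _ _ hM].
  by rewrite -(subrK w u) rpredD in nu.
have /null_idealP/(_ _ v0)[K hK] := uw.
pose n := maxn N (maxn M K).
have [Nn Mn Kn] : [/\ (N <= n)%N, (M <= n)%N & (K <= n)%N].
  by split; rewrite !leq_max leqnn ?orbT.
rewrite -(hM n) // -(hN n) //; apply: ratnorm_stable.
by rewrite -opprB ratnormN hN // hK.
Qed.

Lemma padic_norm0 : padic_norm 0 = 0.
Proof.
rewrite -[0](rmorph0 (\pi_Q : cauchy p -> Q)) padic_normE.
by case: cauchy_normP => // v N; rewrite rpred0.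
Qed.

Lemma padic_norm_eq0 (x : Q) : (padic_norm x == 0) = (x == 0).
Proof.
elim/quotW: x => u; rewrite padic_normE padic_pi_eq0.
by case: cauchy_normP => [->|v N /negbTE -> /gt_eqF]; rewrite ?eqxx.
Qed.

Lemma padic_normN (x : Q) : padic_norm (- x) = padic_norm x.
Proof.
elim/quotW: x => u; rewrite -rmorphN !padic_normE; congr (xget _ _).
by apply/funext => v /=; apply/propext; split => -[N h]; exists N => n /h;
  rewrite ratnormN.
Qed.

Lemma padic_normM (x y : Q) : padic_norm (x * y) = padic_norm x * padic_norm y.
Proof.
have [->|] := eqVneq x 0; first by rewrite mul0r padic_norm0 mul0r.
have [->|] := eqVneq y 0; first by rewrite mulr0 padic_norm0 mulr0.
elim/quotW: x => u; elim/quotW: y => w; rewrite -rmorphM !padic_normE.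
rewrite !padic_pi_eq0 => nw nu.
case: (cauchy_normP u) nu => [->//|v N _ v0 hN _].
case: (cauchy_normP w) nw => [->//|v' M _ v0' hM _].
apply: xget_unique => [|t [K hK]].
  by exists (maxn N M) => n; rewrite geq_max => /andP[? ?]; rewrite ratnormM hN ?hM.
pose n := maxn N (maxn M K).
have [Nn Mn Kn] : [/\ (N <= n)%N, (M <= n)%N & (K <= n)%N].
  by split; rewrite !leq_max leqnn ?orbT.
by rewrite -(hK n) // ratnormM hN ?hM.
Qed.

Lemma padic_normD (x y : Q) :
  padic_norm (x + y) <= Num.max (padic_norm x) (padic_norm y).
Proof.
elim/quotW: x => u; elim/quotW: y => w; rewrite -rmorphD !padic_normE.
case: (cauchy_normP (u + w)) => [_|t K _ t0 hK].
  rewrite le_max.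
  by case: (cauchy_normP u) => [_|v N _ /ltW ->//]; rewrite lexx.
pose small (z : cauchy p) := exists N, forall n, (N <= n)%N ->
  ratnorm p (z n) < t.
have P z : cauchy_norm z < t -> small z.
  case: cauchy_normP => [/null_idealP/(_ _ t0)//|v N _ _ hN vt].
  by exists N => n /hN ->.
rewrite leNgt; apply/negP; rewrite gt_max => /andP[/P[N hN] /P[M hM]].
pose n := maxn N (maxn M K).
have [Nn Mn Kn] : [/\ (N <= n)%N, (M <= n)%N & (K <= n)%N].
  by split; rewrite !leq_max leqnn ?orbT.
have := ratnormD p (u n) (w n); rewrite -[u n + w n]/((u + w) n) (hK n) //.
by rewrite leNgt gt_max hN ?hM.
Qed.

Definition padic_dist (x y : Q) : rat := padic_norm (x - y).

Fact padic_distxx (x : Q) : padic_dist x x = 0.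
Proof. by rewrite /padic_dist subrr padic_norm0. Qed.

Fact padic_dist_eq0 (x y : Q) : padic_dist x y = 0 -> x = y.
Proof. by move=> /eqP; rewrite padic_norm_eq0 subr_eq0 => /eqP. Qed.

Fact padic_dist_sym (x y : Q) : padic_dist x y = padic_dist y x.
Proof. by rewrite /padic_dist -opprB padic_normN. Qed.

Lemma padic_norm_ge0 (x : Q) : 0 <= padic_norm x.
Proof. by rewrite /padic_norm; case: cauchy_normP => // v N _ /ltW. Qed.

Fact padic_dist_triangle (y x z : Q) :
  padic_dist x z <= padic_dist x y + padic_dist y z.
Proof.
have -> : padic_dist x z = padic_norm ((x - y) + (y - z)) by rewrite addrA subrK.
apply: (le_trans (padic_normD _ _)).
by rewrite ge_max lerDl lerDr !padic_norm_ge0.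
Qed.

HB.instance Definition _ := isMetric.Build rat (padic p)
  padic_distxx padic_dist_eq0 padic_dist_sym padic_dist_triangle.

Definition cauchy_cst (q : rat) : cauchy p.
Proof.
apply: (@Cauchy p (fun=> q)).
by apply/asboolP => e e0; exists 0%N => m n _ _; rewrite subrr ratnorm0.
Defined.

Lemma padic_intE (n : int) : n%:~R = \pi_Q (cauchy_cst n%:~R).
Proof.
rewrite -[LHS](rmorph_int (\pi_Q : cauchy p -> Q)); congr (\pi_Q _).
apply/val_inj/funext => k /=.
have E (m : nat) : (m%:R : cauchy p) k = m%:R.
  by elim: m => [//|m IH]; rewrite -natr1 -[m.+1%:R]natr1 -IH.
by case: n => m; [exact: E | exact: (congr1 -%R (E m.+1))].
Qed.

Lemma padic_norm_cst (q : rat) : padic_norm (\pi_Q (cauchy_cst q)) = ratnorm p q.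
Proof.
rewrite padic_normE; apply: xget_unique; first by exists 0%N.
by move=> v [N /(_ N (leqnn N))].
Qed.

Lemma padic_norm_int (n : int) : padic_norm (n%:~R) = ratnorm p n%:~R.
Proof. by rewrite padic_intE padic_norm_cst. Qed.

Lemma padic_rat_dense (x : Q) (e : rat) : 0 < e ->
  exists n d : int, d%:~R != 0 :> Q /\ padic_norm (x - n%:~R / d%:~R) < e.
Proof.
elim/quotW: x => u e0; have [N hN] := asboolP _ (cauchyP u) e e0.
pose q := u N; exists (numq q), (denq q).
have d0 : (denq q)%:~R != 0 :> Q.
  by rewrite -padic_norm_eq0 padic_norm_int ratnorm_eq0 intr_eq0 denq_neq0.
split=> //; suff -> : (numq q)%:~R / (denq q)%:~R = \pi_Q (cauchy_cst q).
  rewrite -rmorphB padic_normE; case: cauchy_normP => // v M _ _ hM.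
  rewrite -(hM (maxn N M)) ?leq_maxr //; apply: hN => //; exact: leq_maxl.
apply: (canLR (mulfK d0)); rewrite !padic_intE -rmorphM; congr (\pi_Q _).
by apply/val_inj/funext => k; rewrite /= numqE.
Qed.

End PadicField.

Lemma padic_denseP (p : nat) (S : set (padic p)) :
  dense S <-> forall (x : padic p) (e : rat), 0 < e ->
    exists2 y, S y & padic_norm (x - y) < e.
Proof.
have ballE (x : padic p) (e : rat) : ball x e = [set y | padic_norm (x - y) < e].
  exact: ballEmdist.
split=> [dS x e e0|dS U [x Ux] oU].
  have [|y [/interior_subset]] := dS (interior (ball x e)) _ (open_interior _).
    by exists x; exact: nbhsx_ballx.
  by rewrite ballE => ? ?; exists y.
have /nbhs_ballP[e /= e0 eU] := open_nbhs_nbhs (conj oU Ux).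
have [y Sy xy] := dS x e e0; exists y; split => //; apply: eU.
by rewrite ballE.
Qed.

Definition quotient_set (F : fieldType) (x : nat -> int) : set F :=
  [set z | exists m n : nat, x n <> 0 /\ z = (x m)%:~R / (x n)%:~R].

Arguments quotient_set F x : clear implicits.

(* Main.v *)
(* Along the exponents n = (p - 1) p^r s, Euler's theorem gives
   a^n = 1 + p^(r+1) q(s) for every integer a prime to p, where q is 1-Lipschitz
   for the p-adic absolute value. Hence, for suitable r, an exponential
   polynomial becomes, up to a constant factor, s |-> u + v s + p g(s) with v
   prime to p and g again 1-Lipschitz. Such a sequence takes values p-adically
   close to every integer: p g is constant modulo p^(k+1) on classes modulo p^k,
   so the digits of a solution s can be adjusted one at a time as in Hensel's
   lemma. Quotients of its terms then approximate every rational number, and the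
   explicit solutions of the recurrence are exponential polynomials.
   Conversely, for a triple root a with x_0 = 0 and 4 a x_1 = x_2, the solution
   is a constant multiple of a^n n^2, so that all quotients have even p-adic
   valuation and stay away from p. *)
Require Import Defs.
From HB Require Import structures.
From mathcomp Require Import all_boot all_order all_algebra.
From mathcomp Require Import cyclic.
From mathcomp Require Import boolp classical_sets functions topology.
From mathcomp Require Import ring.

Set Implicit Arguments.
Unset Strict Implicit.
Unset Printing Implicit Defensive.

Import Order.TTheory GRing.Theory Num.Theory.

Local Open Scope ring_scope.

Lemma PoszX (m n : nat) : (m ^ n)%N%:Z = m%:Z ^+ n.
Proof. by rewrite -natz natrX natz. Qed.

Lemma horner_drop2 (R : comNzRingType) (F : {poly R}) (t : R) :
  F.[t] = F`_0 + F`_1 * t + t ^+ 2 * (drop_poly 2 F).[t].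
Proof.
rewrite -{1}(poly_take_drop 2 F) hornerD hornerM hornerXn mulrC.
by rewrite horner_poly 2!big_ord_recl big_ord0 /= expr0 expr1 mulr1 addr0.
Qed.

Lemma ndvdz_neq0 (d m : int) : ~~ (d %| m)%Z -> m != 0.
Proof. by apply: contra => /eqP->; rewrite dvdz0. Qed.

Section IntegerDivisibility.
Variable p : nat.
Hypothesis p_prime : prime p.

Lemma Euclid_dvdzM (m n : int) :
  (p%:Z %| m * n)%Z = (p%:Z %| m)%Z || (p%:Z %| n)%Z.
Proof. by rewrite !dvdzE abszM Euclid_dvdM. Qed.

Lemma coprimez_prime (m : int) : coprimez m p%:Z = ~~ (p%:Z %| m)%Z.
Proof. by rewrite coprimezE coprime_sym prime_coprime. Qed.

Lemma prime_ndvd_pred : ~~ (p %| p.-1)%N.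
Proof. by case: p p_prime => [|[|n]] // _; rewrite gtnNdvd. Qed.

Lemma pfactor_dvdz (k : nat) (m : int) :
  m != 0 -> (p%:Z ^+ k %| m)%Z = (k <= logn p `|m|)%N.
Proof. by move=> m0; rewrite dvdzE abszX pfactor_dvdn ?absz_gt0. Qed.

Lemma logn_absz_ndvdz (m : int) : ~~ (p%:Z %| m)%Z -> logn p `|m| = 0%N.
Proof. by move=> pm; rewrite logn_coprime // prime_coprime. Qed.

Lemma pfactor_decompz (m : int) : m != 0 ->
  exists2 m' : int, m = p%:Z ^+ logn p `|m| * m' & ~~ (p%:Z %| m')%Z.
Proof.
move=> m0; set k := logn p `|m|.
have /dvdzP[m' mE] : (p%:Z ^+ k %| m)%Z by rewrite pfactor_dvdz.
exists m'; first by rewrite mulrC.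
have : ~~ (p%:Z ^+ k.+1 %| m)%Z by rewrite pfactor_dvdz // ltnn.
by apply: contra => pm'; rewrite exprS mE dvdz_mul.
Qed.

Lemma solve_linear_modz (u c : int) : ~~ (p%:Z %| u)%Z ->
  exists j : nat, (p%:Z %| c + u * j%:Z)%Z.
Proof.
rewrite -coprimez_prime => /coprimezP[[v w] /= vuE].
pose j := ((- c * v) %% p%:Z)%Z.
have j_ge0 : 0 <= j by rewrite modz_ge0 // -lt0n prime_gt0.
exists `|j|%N; rewrite gez0_abs //.
have -> : c + u * j = c * (1 - v * u) + u * (j - - c * v) by ring.
rewrite rpredD // dvdz_mull //; last by rewrite -eqz_mod_dvd modz_mod.
by rewrite -vuE [_ + w * _]addrC addrK dvdz_mull.
Qed.

End IntegerDivisibility.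

Lemma Euler_exp_totientz (a : int) (n : nat) : coprimez a n%:Z ->
  (a ^+ totient n = 1 %[mod n%:Z])%Z.
Proof.
case: n => [//|n] co_an; rewrite -modzXm.
have r_ge0 : 0 <= (a %% n.+1%:Z)%Z by rewrite modz_ge0.
have co_rn : coprime `|(a %% n.+1%:Z)%Z| n.+1.
  rewrite -[coprime _ _]/(coprimez (a %% n.+1%:Z)%Z n.+1%:Z).
  by rewrite /coprimez gcdz_modl.
rewrite -(gez0_abs r_ge0) -PoszX -[1]/(1%N%:Z) !modz_nat.
by rewrite Euler_exp_totient.
Qed.

Section PadicNorm.
Variable p : nat.
Hypothesis p_prime : prime p.

Lemma padic_norm1 : padic_norm (1 : padic p) = 1.
Proof. by rewrite -[1 : padic p]/(1%:~R) padic_norm_int ratnorm1. Qed.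

Lemma padic_normV (x : padic p) : padic_norm x^-1 = (padic_norm x)^-1.
Proof.
have [->|x0] := eqVneq x 0; first by rewrite invr0 padic_norm0 invr0.
have Nx0 : padic_norm x != 0 by rewrite padic_norm_eq0.
by apply: (mulIf Nx0); rewrite -padic_normM !mulVf // padic_norm1.
Qed.

Lemma padic_norm_stable (x y : padic p) :
  padic_norm (x - y) < padic_norm y -> padic_norm x = padic_norm y.
Proof.
move=> xy; apply/eqP; rewrite eq_le; apply/andP; split.
  by have := padic_normD (x - y) y; rewrite subrK (max_idPr (ltW xy)).
have := padic_normD (y - x) x; rewrite subrK le_max => /orP[|//].
by rewrite -opprB padic_normN leNgt xy.
Qed.

Lemma padic_intr_eq0 (m : int) : (m%:~R == 0 :> padic p) = (m == 0).
Proof. by rewrite -padic_norm_eq0 padic_norm_int ratnorm_eq0 intr_eq0. Qed.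

Lemma padic_norm_int_logn (m : int) : m != 0 ->
  padic_norm (m%:~R : padic p) = p%:R ^- logn p `|m|.
Proof.
move=> m0; rewrite padic_norm_int -[m%:~R]divr1 -[1]/(1%:~R) ratnorm_frac //.
by rewrite logn1 sub0r -exprnN.
Qed.

Lemma padic_norm_int_le (m : int) k :
  (padic_norm (m%:~R : padic p) <= p%:R ^- k) = (p%:Z ^+ k %| m)%Z.
Proof.
have p_gt0 : 0 < (p%:R : rat) by rewrite ltr0n prime_gt0.
have [->|m0] := eqVneq m 0.
  by rewrite dvdz0 padic_norm0 invr_ge0 exprn_ge0 // ltW.
rewrite padic_norm_int_logn // lef_pV2 ?posrE ?exprn_gt0 //.
by rewrite ler_eXn2l ?ltr1n ?prime_gt1 // pfactor_dvdz.
Qed.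

Lemma prime_expVn_small (e : rat) : 0 < e -> exists k, p%:R ^- k < e.
Proof.
move=> e0; exists (Num.bound e^-1).
rewrite invf_plt ?posrE ?exprn_gt0 ?ltr0n ?prime_gt0 //.
apply: lt_le_trans (upper_nthrootP (leqnn _)) _.
by rewrite lerXn2r ?nnegrE ?ler0n // ler_nat prime_gt1.
Qed.

End PadicNorm.

Section QuotientSets.
Variable p : nat.
Hypothesis p_prime : prime p.
Implicit Types w x : nat -> int.

Definition padically_dense w : Prop :=
  forall (t : int) k, exists s, (p%:Z ^+ k %| w s - t)%Z.

Lemma dense_quotient_set w :
  padically_dense w -> dense (quotient_set (padic p) w).
Proof.
move=> w_dense; apply/padic_denseP => z e e0.
have [n [d [d0 z_near]]] := padic_rat_dense z e0.
set r := padic_norm (d%:~R : padic p).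
have r0 : 0 < r by rewrite lt_def padic_norm_ge0 padic_norm_eq0 d0.
have [k] : exists k, p%:R ^- k < Num.min r (e * (r * r)).
  by apply: prime_expVn_small; rewrite // lt_min r0 !mulr_gt0.
rewrite lt_min => /andP[k_r k_err].
have [i wi] := w_dense n k; have [j wj] := w_dense d k.
have Nwj : padic_norm ((w j)%:~R : padic p) = r.
  apply: padic_norm_stable; rewrite -intrB.
  by apply: le_lt_trans k_r; rewrite padic_norm_int_le.
have wj0 : (w j)%:~R != 0 :> padic p by rewrite -padic_norm_eq0 Nwj gt_eqF.
exists ((w i)%:~R / (w j)%:~R).
  by exists i, j; split=> //; apply/eqP; rewrite -(padic_intr_eq0 p).
rewrite -[z](subrK (n%:~R / d%:~R)) -addrA.
apply: le_lt_trans (padic_normD _ _) _; rewrite gt_max z_near /=.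
rewrite -mulNr addf_div // padic_normM padic_normV padic_normM Nwj -/r.
rewrite ltr_pdivrMr ?mulr_gt0 // mulNr -!intrM -intrB.
apply: le_lt_trans k_err; rewrite padic_norm_int_le //.
have -> : n * w j - w i * d = n * (w j - d) - (w i - n) * d by ring.
by apply: rpredB; [exact: dvdz_mull | exact: dvdz_mulr].
Qed.

Lemma sub_quotient_set (F : fieldType) x w (f : nat -> nat) (C K : int) :
  C%:~R != 0 :> F -> K%:~R != 0 :> F -> (forall s, C * x (f s) = K * w s) ->
  (quotient_set F w `<=` quotient_set F x)%classic.
Proof.
move=> C0 K0 xw _ [i [j [wj0 ->]]]; exists (f i), (f j); split.
  move=> xj0; have /esym/eqP := xw j; rewrite xj0 mulr0 mulf_eq0.
  by move=> /orP[/eqP KE|/eqP//]; rewrite KE eqxx in K0.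
have scaled (c n d : F) : c != 0 -> n / d = (c * n) / (c * d).
  by move=> c0; rewrite -mulf_div divff // mul1r.
by rewrite (scaled _ _ _ K0) (scaled _ (x _)%:~R _ C0) -!intrM !xw.
Qed.

Lemma dense_quotient_set_of_subseq x w (f : nat -> nat) (C K : int) :
  C != 0 -> K != 0 -> (forall s, C * x (f s) = K * w s) ->
  padically_dense w -> dense (quotient_set (padic p) x).
Proof.
move=> C0 K0 xw /dense_quotient_set/padic_denseP w_dense.
apply/padic_denseP => z e /(w_dense z)[y wy zy]; exists y => //.
by apply: sub_quotient_set xw _ wy; rewrite padic_intr_eq0.
Qed.

Lemma not_dense_of_logn_parity x (b : bool) :
  (forall n, x n != 0 -> odd (logn p `|x n|) = b) ->
  ~ dense (quotient_set (padic p) x).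
Proof.
move=> x_parity /padic_denseP x_dense.
have p0 : (p%:R : rat) != 0 by rewrite pnatr_eq0 -lt0n prime_gt0.
have Np : padic_norm (p%:Z%:~R : padic p) = p%:R^-1.
  by rewrite padic_norm_int_logn ?logn_prime ?eqxx ?expr1 // -lt0n prime_gt0.
have pV_gt0 : 0 < (p%:R^-1 : rat) by rewrite invr_gt0 ltr0n prime_gt0.
have [_ [m [n [/eqP xn0 ->]]] q_near] := x_dense p%:Z%:~R _ pV_gt0.
have Nq : padic_norm ((x m)%:~R / (x n)%:~R : padic p) = p%:R^-1.
  by rewrite -Np; apply: padic_norm_stable; rewrite -opprB padic_normN Np.
have xm0 : x m != 0.
  by apply: contra_eq_neq Nq => ->; rewrite mul0r padic_norm0 lt_eqF.
have : logn p `|x m| = (logn p `|x n|).+1.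
  apply: (@ieexprIn rat p%:R); rewrite ?ltr0n ?prime_gt0 //.
    by rewrite pnatr_eq1 gtn_eqF ?prime_gt1.
  apply: invr_inj; rewrite exprSr invfM -Nq padic_normM padic_normV.
  by rewrite !padic_norm_int_logn // mulrC divfK // invr_eq0 expf_neq0.
by move/(congr1 odd); rewrite /= !x_parity //; case: b {x_parity}.
Qed.

End QuotientSets.

Section LipschitzSequences.
Variable p : nat.
Hypothesis p_prime : prime p.
Implicit Types g h : nat -> int.

(* |g t - g s|_p <= |t - s|_p for t = s + p^k j *)
Definition padic_lipschitz g : Prop :=
  forall k s j, (p%:Z ^+ k %| g (s + p ^ k * j)%N - g s)%Z.

Lemma padic_lipschitz_cst (c : int) : padic_lipschitz (fun=> c).
Proof. by move=> k s j; rewrite subrr dvdz0. Qed.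

Lemma padic_lipschitz_natz : padic_lipschitz Posz.
Proof. by move=> k s j; rewrite PoszD addrC addKr PoszM PoszX dvdz_mulr. Qed.

Lemma padic_lipschitzD g h : padic_lipschitz g -> padic_lipschitz h ->
  padic_lipschitz (fun s => g s + h s).
Proof. by move=> gL hL k s j; rewrite opprD addrACA rpredD. Qed.

Lemma padic_lipschitzM g h : padic_lipschitz g -> padic_lipschitz h ->
  padic_lipschitz (fun s => g s * h s).
Proof.
move=> gL hL k s j; set t := (s + _)%N.
have -> : g t * h t - g s * h s = g t * (h t - h s) + (g t - g s) * h s by ring.
by apply: rpredD; [exact/dvdz_mull/hL | exact/dvdz_mulr/gL].
Qed.

Lemma padic_lipschitz_dilation (m : nat) g :
  padic_lipschitz g -> padic_lipschitz (fun s => g (m * s)%N).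
Proof. by move=> gL k s j; rewrite mulnDr mulnCA. Qed.

Lemma padic_lipschitz_sum (I : finType) (g : I -> nat -> int) :
  (forall i, padic_lipschitz (g i)) -> padic_lipschitz (fun s => \sum_i g i s).
Proof. by move=> gL k s j; rewrite -sumrB rpred_sum // => i _; apply: gL. Qed.

Lemma padic_lipschitz_horner (F : {poly int}) :
  padic_lipschitz (fun s => F.[s%:Z]).
Proof.
elim/poly_ind: F => [|F c FL] k s j; first by rewrite !horner0 subrr dvdz0.
rewrite !hornerMXaddC opprD addrACA subrr addr0.
exact: (padic_lipschitzM FL padic_lipschitz_natz).
Qed.

Lemma Euler_quotient_lipschitz (a : int) r : ~~ (p%:Z %| a)%Z ->
  exists2 q, padic_lipschitz q &
    forall s, a ^+ (p.-1 * (p ^ r * s)) = 1 + p%:Z ^+ r.+1 * q s.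
Proof.
move=> pa; set m := p%:Z ^+ r.+1.
have m0 : m != 0 by rewrite expf_neq0 // -lt0n prime_gt0.
have euler k j : (m * p%:Z ^+ k %| a ^+ (p.-1 * (p ^ r * (p ^ k * j))) - 1)%Z.
  rewrite !mulnA -(mulnA p.-1) -expnD exprM -(expr1n _ j) subrXX dvdz_mulr //.
  rewrite -exprD addSn -[(r + k)%N]/(r + k).+1.-1 -totient_pfactor // -PoszX.
  rewrite -eqz_mod_dvd; apply/eqP/Euler_exp_totientz.
  by rewrite PoszX coprimezXr // coprimez_prime.
pose q s := ((a ^+ (p.-1 * (p ^ r * s)) - 1) %/ m)%Z.
have qE s : m * q s = a ^+ (p.-1 * (p ^ r * s)) - 1.
  by rewrite mulrC divzK //; have := euler 0%N s; rewrite expr0 mulr1 mul1n.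
exists q => [k s j|s]; last by rewrite qE addrC subrK.
rewrite -(dvdz_mul2l m0) mulrBr !qE opprB addrA subrK.
by rewrite !mulnDr exprD -[X in _ - X]mulr1 -mulrBr dvdz_mull.
Qed.

Lemma padically_dense_affineD (u v : int) g :
  ~~ (p%:Z %| v)%Z -> padic_lipschitz g ->
  padically_dense p (fun s => u + v * s%:Z + p%:Z * g s).
Proof.
set w := fun s => _; move=> pv gL t k; elim: k => [|k [s /dvdzP[c cE]]].
  by exists 0%N; rewrite expr0 dvd1z.
have [j cvj] := solve_linear_modz p_prime c pv.
exists (s + p ^ k * j)%N.
have -> : w (s + p ^ k * j)%N - t =
    p%:Z ^+ k * (c + v * j%:Z) + p%:Z * (g (s + p ^ k * j)%N - g s).
  by rewrite -[LHS](subrK (w s - t)) {2}cE /w PoszD PoszM -PoszX; ring.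
by rewrite rpredD // exprS ?[p%:Z * _]mulrC dvdz_mul.
Qed.

End LipschitzSequences.

Section ExponentialPolynomials.
Variable p : nat.
Hypothesis p_prime : prime p.

Lemma exp_horner_expansion (a : int) (F : {poly int}) d :
  ~~ (p%:Z %| a)%Z -> (p%:Z ^+ d %| F`_0)%Z ->
  exists2 g, padic_lipschitz p g &
    forall s, let n := (p.-1 * (p ^ d.+1 * s))%N in
      a ^+ n * F.[n%:Z] = F`_0 + F`_1 * n%:Z + p%:Z ^+ d.*2.+2 * g s.
Proof.
move=> pa /dvdzP[c F0E].
have [q qL aE] := Euler_quotient_lipschitz p_prime d.+1 pa.
pose n s := (p.-1 * (p ^ d.+1 * s))%N; pose v s : int := (p.-1 * s)%N%:Z.
pose h s := (drop_poly 2 F).[(n s)%:Z].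
have nE s : (n s)%:Z = p%:Z ^+ d.+1 * v s by rewrite /n mulnCA PoszM PoszX.
have vL : padic_lipschitz p v.
  exact: padic_lipschitz_dilation (@padic_lipschitz_natz p).
have hL : padic_lipschitz p h.
  have polyL := padic_lipschitz_horner p (drop_poly 2 F).
  exact: (padic_lipschitz_dilation _ (padic_lipschitz_dilation p.-1 polyL)).
pose g s := v s * v s * h s +
  q s * (c + p%:Z * (v s * (F`_1 + p%:Z ^+ d.+1 * (v s * h s)))).
have gL : padic_lipschitz p g.
  by do ?[apply: padic_lipschitzD | apply: padic_lipschitzM
         | apply: padic_lipschitz_cst].
exists g => // s /=; rewrite -/(n s) aE horner_drop2 -/(h s) nE F0E.
rewrite /g -addnn !exprS !exprD; ring.
Qed.

(* Along n = (p - 1) p^(d+1) s the linear term has valuation at least 2 d + 1,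
   while the powers a_i^n and the quadratic terms contribute only multiples of
   p^(2 d + 2). *)
Lemma dense_of_exponential_polynomial (I : finType) (x : nat -> int) (C : int)
    (a : I -> int) (F : I -> {poly int}) :
  let d := logn p `|\sum_i (F i)`_1| in
  C != 0 -> \sum_i (F i)`_1 != 0 -> (forall i, ~~ (p%:Z %| a i)%Z) ->
  (forall i, p%:Z ^+ d %| (F i)`_0)%Z ->
  (p%:Z ^+ d.*2.+1 %| \sum_i (F i)`_0)%Z ->
  (forall n, C * x n = \sum_i a i ^+ n * (F i).[n%:Z]) ->
  dense (quotient_set (padic p) x).
Proof.
move=> d C0 F1_neq0 pa F0_d /dvdzP[c F0E] xE.
have [b F1E pb] := pfactor_decompz p_prime F1_neq0; rewrite -/d in F1E.
have /fin_all_exists2[g gL gE] i := exp_horner_expansion (pa i) (F0_d i).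
pose n s := (p.-1 * (p ^ d.+1 * s))%N.
pose w s := c + b * (p.-1)%:Z * s%:Z + p%:Z * \sum_i g i s.
have pd0 : p%:Z ^+ d.*2.+1 != 0 by rewrite expf_neq0 // -lt0n prime_gt0.
apply: (dense_quotient_set_of_subseq p_prime (f := n) (w := w) C0 pd0) => [s|].
  rewrite xE (eq_bigr _ (fun i _ => gE i s)) !big_split /=.
  by rewrite -mulr_suml -mulr_sumr F0E F1E /w /n !PoszM PoszX -addnn
    !exprS !exprD; ring.
apply: padically_dense_affineD (padic_lipschitz_sum gL) => //.
by rewrite Euclid_dvdzM // negb_or pb /= dvdzE prime_ndvd_pred.
Qed.

End ExponentialPolynomials.

Section CubicRecurrences.
Variable R : comNzRingType.
Implicit Types (a b c : R) (x y : nat -> R).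

Definition cubic_rec_roots a b c x : Prop := forall n,
  x n.+3 = (a + b + c) * x n.+2 - (a * b + b * c + c * a) * x n.+1
           + a * b * c * x n.

Lemma cubic_rec_roots_scale a b c x k :
  cubic_rec_roots a b c x -> cubic_rec_roots a b c (fun n => k * x n).
Proof. by move=> xrec n; rewrite xrec; ring. Qed.

Lemma cubic_rec_roots_unique a b c x y :
  cubic_rec_roots a b c x -> cubic_rec_roots a b c y ->
  x 0%N = y 0%N -> x 1%N = y 1%N -> x 2%N = y 2%N -> x =1 y.
Proof.
move=> xrec yrec xy0 xy1 xy2 n.
suff [] : [/\ x n = y n, x n.+1 = y n.+1 & x n.+2 = y n.+2] by [].
elim: n => [//|n [xyn xyn1 xyn2]]; split=> //.
by rewrite xrec yrec xyn xyn1 xyn2.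
Qed.

Lemma triple_root_solution a x : cubic_rec_roots a a a x ->
  forall n, 2 * a ^+ 2 * x n = a ^+ n * (2 * a ^+ 2 * x 0%N
    + (4 * a * x 1%N - x 2%N - 3 * a ^+ 2 * x 0%N) * n%:R
    + (x 2%N - 2 * a * x 1%N + a ^+ 2 * x 0%N) * n%:R ^+ 2).
Proof.
move=> /(cubic_rec_roots_scale (2 * a ^+ 2)) xrec.
apply: (cubic_rec_roots_unique xrec) => [n|||]; try by ring.
rewrite !exprS; ring.
Qed.

Lemma double_root_solution a b x : cubic_rec_roots a b a x ->
  let Q := (a - b) * (x 2%N - x 1%N * (a + b) + x 0%N * a * b) in
  let S := a * (x 2%N - 2 * a * x 1%N + a ^+ 2 * x 0%N) in
  forall n, a * (a - b) ^+ 2 * x n =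
    a ^+ n * (a * (a - b) ^+ 2 * x 0%N - S + Q * n%:R) + S * b ^+ n.
Proof.
move=> /(cubic_rec_roots_scale (a * (a - b) ^+ 2)) xrec Q S.
apply: (cubic_rec_roots_unique xrec) => [n|||]; rewrite /Q /S; try by ring.
rewrite !exprS; ring.
Qed.

Lemma cubic_Vieta (b1 b2 b3 a b c : R) :
  'X^3 - b1 *: 'X^2 - b2 *: 'X - b3%:P
    = ('X - a%:P) * ('X - b%:P) * ('X - c%:P) ->
  [/\ b1 = a + b + c, b2 = - (a * b + b * c + c * a) & b3 = a * b * c].
Proof.
have -> : ('X - a%:P) * ('X - b%:P) * ('X - c%:P) = 'X^3 - (a + b + c) *: 'X^2
    - (- (a * b + b * c + c * a)) *: 'X - (a * b * c)%:P.
  by rewrite -!mul_polyC !(polyCN, polyCD, polyCM); ring.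
move=> charE; have coef_charE i := congr1 (fun q : {poly R} => q`_i) charE.
by split; apply: oppr_inj;
  [have := coef_charE 2 | have := coef_charE 1%N | have := coef_charE 0%N];
  rewrite !(coefB, coefZ, coefC, coefXn, coefX) /=
    !(mulr0, mulr1, oppr0, addr0, add0r).
Qed.

End CubicRecurrences.

Section Density.
Variables (p : nat) (x : nat -> int).
Hypothesis p_prime : prime p.

Lemma not_dense_of_square_multiple (C E : int) (u y : nat -> int) :
  C != 0 -> (forall n, ~~ (p%:Z %| u n)%Z) ->
  (forall n, C * x n = E * u n * y n ^+ 2) ->
  ~ dense (quotient_set (padic p) x).
Proof.
move=> C0 pu xE.
pose b := odd (logn p `|E|) (+) odd (logn p `|C|).
apply: (not_dense_of_logn_parity p_prime (b := b)) => n xn0.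
have := mulf_neq0 C0 xn0; rewrite xE mulf_eq0 mulf_eq0 expf_eq0 !negb_or.
move=> /andP[/andP[E0 un0] /= yn0].
have /(congr1 (fun m : int => odd (logn p `|m|))) := xE n.
rewrite expr2 !abszM !lognM ?muln_gt0 ?absz_gt0 ?E0 ?un0 ?yn0 // addnn.
rewrite (logn_absz_ndvdz p_prime (pu n)) addn0 !oddD odd_double addbF /b => <-.
by rewrite addbC addKb.
Qed.

Lemma dense_of_triple_root (a : int) : cubic_rec_roots a a a x ->
  let D := 4 * a * x 1%N - x 2%N - 3 * a ^+ 2 * x 0%N in
  ~~ (p%:Z %| a)%Z -> D != 0 -> (p%:Z ^+ (logn p `|D|).*2.+1 %| x 0%N)%Z ->
  dense (quotient_set (padic p) x).
Proof.
move=> xrec D pa D0 x0_D.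
pose F := Poly [:: 2 * a ^+ 2 * x 0%N; D;
  x 2%N - 2 * a * x 1%N + a ^+ 2 * x 0%N].
apply: (@dense_of_exponential_polynomial _ p_prime 'I_1 x (2 * a ^+ 2)
  (fun=> a) (fun=> F)) => [||i|i||n]; rewrite ?big_ord1 ?coef_Poly //=.
- by rewrite mulf_neq0 // expf_neq0 // (ndvdz_neq0 pa).
- rewrite dvdz_mull //; apply: dvdz_trans x0_D; apply: dvdz_exp2l.
  by rewrite -addnn leqW // leq_addr.
- exact: dvdz_mull.
- by rewrite (triple_root_solution xrec) -/D horner_Poly (natz n) /=; ring.
Qed.

Lemma not_dense_of_triple_root (a : int) : cubic_rec_roots a a a x ->
  ~~ (p%:Z %| a)%Z -> x 0%N = 0 -> 4 * a * x 1%N = x 2%N ->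
  ~ dense (quotient_set (padic p) x).
Proof.
move=> xrec pa x0 x2E; have C0 : 2 * a ^+ 2 != 0.
  by rewrite mulf_neq0 // expf_neq0 // (ndvdz_neq0 pa).
apply: (@not_dense_of_square_multiple _ (x 2%N - 2 * a * x 1%N)
  (fun n => a ^+ n) Posz C0) => n.
  by rewrite -coprimez_prime // coprimezXl // coprimez_prime.
rewrite (triple_root_solution xrec) x0 x2E (natz n); ring.
Qed.

Lemma dense_of_double_root (a b : int) : cubic_rec_roots a b a x ->
  ~~ (p%:Z %| a)%Z -> ~~ (p%:Z %| b)%Z -> (p%:Z %| x 0%N)%Z ->
  ~~ (p%:Z %| (a - b) * (x 2%N - x 1%N * (a + b) + x 0%N * a * b))%Z ->
  dense (quotient_set (padic p) x).
Proof.
move=> xrec pa pb px0.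
have := double_root_solution xrec; set C := a * _ ^+ 2.
set Q := _ * (_ - _ + _); set S := a * (_ + _) => /= xE pQ.
pose F := fun i : bool => Poly (if i then [:: C * x 0%N - S; Q] else [:: S]).
have F0E : \sum_i (F i)`_0 = C * x 0%N by rewrite big_bool !coef_Poly /= subrK.
have F1E : \sum_i (F i)`_1 = Q by rewrite big_bool !coef_Poly /= addr0.
have Q0 := ndvdz_neq0 pQ.
apply: (@dense_of_exponential_polynomial _ p_prime bool x C
  (fun i => if i then a else b) F); rewrite ?F1E ?F0E ?logn_absz_ndvdz //.
- rewrite mulf_neq0 ?(ndvdz_neq0 pa) // expf_neq0 //.
  by apply: contra Q0 => /eqP ab; rewrite /Q ab mul0r.
- by case.
- by rewrite expr1 dvdz_mull.
- by move=> n; rewrite xE big_bool !horner_Poly (natz n) /=; ring.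
Qed.

End Density.

Theorem theorem1p4 (x : nat -> int) (b1 b2 b3 a b c : int) (p : nat)
    (hrec : forall n : nat, (3 <= n)%N ->
      x n = b1 * x (n - 1)%N + b2 * x (n - 2)%N + b3 * x (n - 3)%N)
    (hb3 : b3 <> 0)
    (hchar : 'X^3 - b1 *: 'X^2 - b2 *: 'X - b3%:P
             = ('X - a%:P) * ('X - b%:P) * ('X - c%:P) :> {poly int})
    (hp : prime p)
    (hpabc : ~ (p%:Z %| a * b * c)%Z) :
  (a = b -> b = c ->
     ((p%:Z %| x 0%N)%Z ->
      ~ (p%:Z %| 4 * a * x 1%N - x 2%N - 3 * a ^+ 2 * x 0%N)%Z ->
      dense (quotient_set (padic p) x)) /\
     (x 0%N = 0 ->
      (dense (quotient_set (padic p) x) <-> 4 * a * x 1%N <> x 2%N))) /\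
  (a = c -> a <> b ->
     (p%:Z %| x 0%N)%Z ->
     ~ (p%:Z %| (a - b) * (x 2%N - x 1%N * (a + b) + x 0%N * a * b))%Z ->
     dense (quotient_set (padic p) x)).
Proof.
have [b1E b2E b3E] := cubic_Vieta hchar.
have xrec : cubic_rec_roots a b c x.
  by move=> n; rewrite hrec // !subSS !subn0 b1E b2E b3E mulNr.
have [pa pb] : ~~ (p%:Z %| a)%Z /\ ~~ (p%:Z %| b)%Z.
  by move/negP: hpabc; rewrite !Euclid_dvdzM // !negb_or => /andP[/andP[]].
split=> [ab bc|ac _ px0 /negP pQ]; last first.
  by rewrite -ac in xrec; exact: (dense_of_double_root hp xrec).
rewrite -bc -ab in xrec; split=> [px0 /negP pD|x0].
  apply: (dense_of_triple_root hp xrec pa); first exact: ndvdz_neq0 pD.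
  by rewrite logn_absz_ndvdz.
split=> [x_dense x2E|/eqP x2_neq].
  exact: (not_dense_of_triple_root hp xrec) x_dense.
apply: (dense_of_triple_root hp xrec pa); last by rewrite x0 dvdz0.
by rewrite x0 mulr0 subr0 subr_eq0.
Qed.
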